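(* Let $p\in[1,\infty)$. The space $C_c^\infty(\mathbb{R}^d)$ is dense in $\Lambda_p(\mathbb{R}^d)$; that is, given $f\in\Lambda_p(\mathbb{R}^d)$ and $\varepsilon>0$, there exists $\varphi_\varepsilon\in C_c^\infty(\mathbb{R}^d)$ such that $\|f-\varphi_\varepsilon\|_{\alpha_p}<\varepsilon$.
   Context: $\mathbb{R}^d$ is endowed with the Borel $\sigma$-algebra and the Lebesgue measure, denoted $|\cdot|$. $C_c^\infty(\mathbb{R}^d)$ is the space of smooth compactly supported functions on $\mathbb{R}^d$. $\Lambda_p(\mathbb{R}^d)$ is the set of real-valued measurable functions $f$ on $\mathbb{R}^d$ (identified a.e.) such that for every $\delta>0$ there exists a measurable set $E_\delta$ with $|E_\delta|<\delta$ and $f\chi_{E_\delta^c}\in L_p(\mathbb{R}^d)$. For a measurable function $f$, $\|f\|_{\alpha_p}=\|\min(|f|,1)\|_p$, where $\|\cdot\|_p$ is the $L_p$ norm. *)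

(* Defs.v *)
From HB Require Import structures.
From mathcomp Require Import all_boot all_order all_algebra.
From mathcomp Require Import all_classical all_reals all_analysis.
From mathcomp Require Import measurable_realfun.

Set Implicit Arguments.
Unset Strict Implicit.
Unset Printing Implicit Defensive.

Import Order.TTheory GRing.Theory Num.Theory.
Import numFieldNormedType.Exports.

Local Open Scope classical_set_scope.
Local Open Scope ring_scope.

(** R^d is the type ['rV[R]_d], with the topology of the library (that of the
    sup norm).  [measurable] on matrices is the Borel sigma-algebra. *)
Section borel_matrix.
Context {R : realType} {m n : nat}.

Let G : set (set 'M[R]_(m, n)) := @open 'M[R]_(m, n).

HB.instance Definition _ := @isMeasurable.Build (sigma_display G)
  'M[R]_(m, n) <<s G >> (@sigma_algebra0 _ setT G) (@sigma_algebraC _ G)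
  (@sigma_algebra_bigcup _ setT G).

End borel_matrix.

Section borel_rV.
Context {R : realType}.

Lemma open_measurable_rV n (U : set 'rV[R]_n) : open U -> measurable U.
Proof. by move=> oU; exact: sub_sigma_algebra. Qed.

Lemma open_bigcup_ratball n (U : set 'rV[R]_n) : open U ->
  U = \bigcup_(z in [set z : 'rV[rat]_n * nat |
        ball (map_mx ratr z.1 : 'rV[R]_n) z.2.+1%:R^-1 `<=` U])
      ball (map_mx ratr z.1 : 'rV[R]_n) z.2.+1%:R^-1.
Proof.
move=> oU; apply/seteqP; split=> [x Ux|x [z zU zx]]; last exact: zU.
have /nbhs_ballP[e /= e0 xeU] : nbhs x U by exact: open_nbhs_nbhs.
have [k ke] : exists k, k.+1%:R^-1 < e / 2.
  have e20 : 0 < e / 2 by rewrite divr_gt0.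
  exists (Num.truncn (e / 2)^-1).
  rewrite invf_plt ?posrE//.
  exact: truncnS_gt.
have k0 : 0 < k.+1%:R^-1 :> R by rewrite invr_gt0.
have qP i : exists q : rat, `|ratr q - x 0 i| < k.+1%:R^-1.
  have /rat_in_itvoo[q] : x 0 i - k.+1%:R^-1 < x 0 i + k.+1%:R^-1.
    by rewrite ltrD2l (lt_trans _ k0)// oppr_lt0.
  by rewrite in_itv/= -ltr_distl; exists q.
pose q := \row_i sval (cid (qP i)).
have qx : ball (map_mx ratr q : 'rV[R]_n) k.+1%:R^-1 x.
  split=> // i j; rewrite ord1 !mxE /=.
  by rewrite /ball/=; exact: (svalP (cid (qP j))).
exists (q, k) => //= y qy; apply: xeU.
apply: (@le_ball _ _ _ (k.+1%:R^-1 + k.+1%:R^-1)).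
  by rewrite [leRHS]splitr lerD// ltW.
by apply: ball_triangle qy; exact: ball_sym.
Qed.

Lemma measurable_fun_rV d (T : measurableType d) n (f : T -> 'rV[R]_n) :
  (forall i, measurable_fun [set: T] (fun x => f x 0 i)) ->
  measurable_fun [set: T] f.
Proof.
move=> mf; apply: (@measurability _ _ _ _ _ f (@open 'rV[R]_n)) => //.
move=> _ [U oU <-]; rewrite setTI (open_bigcup_ratball oU) preimage_bigcup.
rewrite bigcup_mkcond.
apply: countable_bigcupT_measurable => [|[q k]]; first exact: countableP.
case: ifPn => _ //.
rewrite (_ : _ @^-1` _ = \bigcap_(i : 'I_n)
    ((fun x => f x 0 i) @^-1` ball (ratr (q 0 i) : R) k.+1%:R^-1)).
  apply: fin_bigcap_measurable => // i _.
  by rewrite -[X in measurable X]setTI; apply: mf => //;  exact: measurable_ball.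
apply/seteqP; split=> x /=.
  by move=> [_ +] i _ => /(_ 0 i); rewrite mxE.
move=> xi; split; first by rewrite invr_gt0.
by move=> i j; rewrite ord1 mxE; exact: xi.
Qed.

Lemma continuous_measurable_fun_rV n (f : 'rV[R]_n -> R) :
  continuous f -> measurable_fun [set: 'rV[R]_n] f.
Proof.
move=> /continuousP cf; apply: (measurability _ (RGenOpens.measurableE R)).
move=> _ [_ [a [b ->]] <-]; rewrite setTI; apply: open_measurable_rV.
exact/cf/interval_open.
Qed.

Lemma measurable_coord n (i : 'I_n) :
  measurable_fun [set: 'rV[R]_n] (fun v => v 0 i).
Proof. by apply: continuous_measurable_fun_rV; exact: coord_continuous. Qed.

Definition cons_rV n (z : 'rV[R]_n * R) : 'rV[R]_n.+1 :=
  row_mx (z.2%:M : 'rV[R]_1) z.1.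

Lemma cons_rV0 n z : @cons_rV n z 0 ord0 = z.2.
Proof.
have -> : @ord0 n = @lshift 1 n ord0 by exact: val_inj.
by apply: etrans (row_mxEl _ _ _ _) _; rewrite mxE mulr1n.
Qed.

Lemma cons_rVS n z i : @cons_rV n z 0 (lift ord0 i) = z.1 0 i.
Proof.
have -> : lift (@ord0 n) i = rshift 1 i by exact: val_inj.
exact: row_mxEr.
Qed.

Lemma measurable_cons_rV n : measurable_fun setT (@cons_rV n).
Proof.
apply: measurable_fun_rV => i; case: (unliftP ord0 i) => [j|] ->.
  under eq_fun do rewrite cons_rVS.
  exact: (measurableT_comp (measurable_coord j) measurable_fst).
under eq_fun do rewrite cons_rV0.
exact: measurable_snd.
Qed.

Definition uncons_rV n (v : 'rV[R]_n.+1) : 'rV[R]_n * R :=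
  (rsubmx (v : 'rV[R]_(1 + n)), v 0 0).

Lemma measurable_uncons_rV n : measurable_fun setT (@uncons_rV n).
Proof.
apply: measurable_fun_pair; last exact: measurable_coord.
apply: measurable_fun_rV => i; under eq_fun do rewrite mxE.
exact: measurable_coord.
Qed.

Lemma cons_rVK n : cancel (@cons_rV n) (@uncons_rV n).
Proof.
by move=> z; rewrite /uncons_rV cons_rV0 [rsubmx _]row_mxKr; case: z.
Qed.

End borel_rV.

Section lebesgue_measure_rV.
Context {R : realType}.
Local Open Scope ereal_scope.

(** Lebesgue measure as an iterated product measure, transported along
    R^n * R ~ R^(n+1); [lebesgue_rV_box] gives its value on boxes. *)
Fixpoint lebesgue_rV (n : nat) : set 'rV[R]_n -> \bar R :=
  match n with
  | 0 => \d_(0%R : 'rV[R]_0)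
  | n'.+1 => pushforward (@lebesgue_rV n' \x @lebesgue_measure R)
               (@cons_rV R n')
  end.

Let lebesgue_rV_spec n : exists2 m : {measure set 'rV[R]_n -> \bar R},
  m = @lebesgue_rV n :> (set 'rV[R]_n -> \bar R) & sigma_finite setT m.
Proof.
elim: n => [|n [m mE sm]].
  by exists \d_(0%R : 'rV[R]_0) => //; exact: sigma_finiteT.
pose P : {measure set _ -> \bar R} := product_measure1 m (@lebesgue_measure R).
pose M : {measure set 'rV[R]_n.+1 -> \bar R} :=
  measure_function_pushforward__canonical__measure_function_Measure P
    (@measurable_cons_rV R n).
exists M; first by rewrite /= -mE.
have /sigma_finiteP[F [FT ndF Foo]] := sm.
have /sigma_finiteP[G [GT ndG Goo]] := sigma_finiteT (@lebesgue_measure R).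
exists (fun i => @uncons_rV R n @^-1` (F i `*` G i)).
  apply/esym/seteqP; split=> // v _.
  have [i _ Fi] : (\bigcup_k F k) (uncons_rV v).1 by rewrite -FT.
  have [j _ Gj] : (\bigcup_k G k) (uncons_rV v).2 by rewrite -GT.
  exists (maxn i j) => //; split.
  - by move: Fi; exact/subsetPset/ndF/leq_maxl.
  - by move: Gj; exact/subsetPset/ndG/leq_maxr.
move=> i; have [mF Fi] := Foo i; have [mG Gi] := Goo i; split.
  rewrite -[X in measurable X]setTI; apply: measurable_uncons_rV => //.
  exact: measurableX.
rewrite /M /= /pushforward -comp_preimage (_ : _ \o _ = id); last first.
  by apply/funext => z; exact: cons_rVK.
rewrite preimage_id [ltLHS]product_measure1E// lte_mul_pinfty//.
by rewrite ge0_fin_numE.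
Qed.

Let lebesgue_rV0 n : @lebesgue_rV n set0 = 0.
Proof. by have [m <- ?] := lebesgue_rV_spec n. Qed.

Let lebesgue_rV_ge0 n A : 0 <= @lebesgue_rV n A.
Proof. by have [m <- ?] := lebesgue_rV_spec n. Qed.

Let lebesgue_rV_semi_sigma_additive n : semi_sigma_additive (@lebesgue_rV n).
Proof.
have [m <- ?] := lebesgue_rV_spec n.
exact: measure_semi_sigma_additive.
Qed.

HB.instance Definition _ n := isMeasure.Build _ _ _ (@lebesgue_rV n)
  (@lebesgue_rV0 n) (@lebesgue_rV_ge0 n) (@lebesgue_rV_semi_sigma_additive n).

Let lebesgue_rV_sigma_finite n : sigma_finite setT (@lebesgue_rV n).
Proof.
by have [m <- ?] := lebesgue_rV_spec n.
Qed.

HB.instance Definition _ n := Measure_isSigmaFinite.Build _ _ _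
  (@lebesgue_rV n) (@lebesgue_rV_sigma_finite n).

Lemma lebesgue_rV_box n (A : 'I_n -> set R) :
  (forall i, measurable (A i)) ->
  @lebesgue_rV n [set v | forall i, A i (v 0%R i)] =
    \prod_(i < n) lebesgue_measure (A i).
Proof.
elim: n A => [A mA|n IH A mA].
  rewrite big_ord0 /= diracE (_ : _ \in _ = true)//.
  by apply/mem_set => -[].
rewrite big_ord_recl /= muleC -IH; last by move=> i.
pose B := [set v : 'rV[R]_n | forall i, A (lift ord0 i) (v 0%R i)].
have mB : measurable B.
  rewrite (_ : B = \bigcap_(i : 'I_n)
      ((fun v : 'rV[R]_n => v 0%R i) @^-1` A (lift ord0 i))).
    apply: fin_bigcap_measurable => // i _.
    by rewrite -[X in measurable X]setTI; exact: measurable_coord.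
  by apply/seteqP; split=> v vA i; [move=> _|]; exact: vA.
rewrite -[in RHS]/B -product_measure1E//; last exact: mA.
rewrite /pushforward; congr (_ _).
apply/seteqP; split=> z /= zA.
  by split=> [i|]; [rewrite -cons_rVS|rewrite -cons_rV0].
move=> i; case: (unliftP ord0 i) => [j|] ->.
  by rewrite cons_rVS; exact: zA.1.
by rewrite cons_rV0; exact: zA.2.
Qed.

End lebesgue_measure_rV.
Arguments lebesgue_rV {R} n.

Section smooth.
Context {R : realType} {d : nat}.
Implicit Type f : 'rV[R]_d -> R.

(** [partials [:: i_1; ...; i_k] f] is the iterated partial derivative
    d_(i_1) ... d_(i_k) f; it is meaningful only when the derivatives exist,
    which [smooth] requires together with the continuity of all of them. *)
Fixpoint partials (s : seq 'I_d) f : 'rV[R]_d -> R :=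
  if s is i :: s' then 'D_(delta_mx 0 i) (partials s' f) else f.

Definition smooth f := forall s : seq 'I_d,
  continuous (partials s f) /\
  forall (i : 'I_d) (x : 'rV[R]_d), derivable (partials s f) x (delta_mx 0 i).

Definition Cc_infty f :=
  smooth f /\ compact (closure [set x | f x != 0]).

End smooth.

Section Lambda.
Context {R : realType} {d : nat}.
Implicit Types (p : R) (f : 'rV[R]_d -> R).

(** Elements of Lambda_p are handled through their representatives. *)
Definition Lambda p f := measurable_fun [set: 'rV[R]_d] f /\
  forall delta : R, 0 < delta -> exists E : set 'rV[R]_d,
    [/\ measurable E, (lebesgue_rV d E < delta%:E)%E &
        (f \* \1_(~` E)) \in Lfun (lebesgue_rV d) p%:E].

Definition alpha_norm p f : \bar R :=
  'N[lebesgue_rV d]_(p%:E)[EFin \o (fun x => Num.min `|f x| 1)].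

End Lambda.

(* Main.v *)
(** On [min(|f|, 1)^p] dominated convergence applies, so the functions that are
    limits of smooth bumps for [alpha_norm] are closed under addition, scaling
    and dominated pointwise limits.  The indicator of an open box is the
    pointwise limit of products of the functions [exp (- 1 / (n (x_i - a_i)))]
    and [exp (- 1 / (n (b_i - x_i)))], extended by 0 outside the box.  Dynkin's
    theorem then gives the indicators of all Borel subsets of a box, simple
    approximation gives [f * 1_B] for every measurable [f] and every box [B],
    and exhausting the space by boxes gives every [f] such that
    [min(|f|, 1)^p] is integrable, in particular the elements of Lambda_p. *)

Require Import Defs.
From HB Require Import structures.
From mathcomp Require Import all_boot all_order all_algebra.
From mathcomp Require Import all_classical all_reals all_analysis.
From mathcomp Require Import measurable_realfun ring lra.

Import Order.TTheory GRing.Theory Num.Theory.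
Import numFieldNormedType.Exports.

Local Open Scope classical_set_scope.
Local Open Scope ring_scope.

(** * The flat functions t^(-k) exp(-1/t) and their derivatives *)

Section flat.
Context {R : realType}.
Implicit Types (k : nat) (t : R).

(** The case k = 0 is the classical function exp(-1/t) extended by 0. The factor t^(-k) is included
    so that derivatives stay in the linear span of the family. *)
Definition flat k t : R := if 0 < t then t^-1 ^+ k * expR (- t^-1) else 0.

Lemma flat_ge0 k t : 0 <= flat k t.
Proof.
rewrite /flat; case: ifPn => // t0.
by rewrite mulr_ge0 ?expR_ge0// exprn_ge0// invr_ge0 ltW.
Qed.

Lemma flat_neq0_gt0 k t : flat k t != 0 -> 0 < t.
Proof. by rewrite /flat; case: ifPn => //; rewrite eqxx. Qed.

(** Keeping only the term of degree k+2 in the exponential series at 1/t gives t^(-k-2) <= (k+2)!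
    exp(1/t). The quadratic bound is what yields a zero derivative at the origin. *)
Lemma flat_le_sqr k t : flat k t <= k.+2`!%:R * t ^+ 2.
Proof.
rewrite /flat; case: ifPn => [t0|_]; last by rewrite mulr_ge0// sqr_ge0.
have y0 : 0 < t^-1 by rewrite invr_gt0.
have F0 : 0 < k.+2`!%:R :> R by rewrite ltr0n fact_gt0.
have h : t^-1 ^+ k.+2 <= k.+2`!%:R * expR t^-1.
  rewrite mulrC -ler_pdivrMr//.
  by rewrite (le_trans _ (expR_ge1Dxn k.+1 (ltW y0)))// lerDr.
rewrite expRN ler_pdivrMr ?expR_gt0//.
have -> : t^-1 ^+ k = t ^+ 2 * t^-1 ^+ k.+2.
  by rewrite !exprS; field; rewrite gt_eqF.
by rewrite [leRHS]mulrAC [leRHS]mulrC; apply: ler_wpM2l; [exact: sqr_ge0|exact: h].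
Qed.

Lemma is_derive_flat k t :
  is_derive t 1 (flat k) (- k%:R * flat k.+1 t + flat k.+2 t).
Proof.
have [t0|t0|->] := ltgtP t 0.
- have flatN j s : s < 0 -> flat j s = 0.
    by move=> s0; rewrite /flat ltNge ltW.
  rewrite !flatN// mulr0 addr0.
  apply: (@near_eq_is_derive _ _ _ (cst 0)).
  by near=> s; rewrite flatN//; near: s; exact: lt_nbhsl.
- have flatP j s : 0 < s -> flat j s = s^-1 ^+ j * expR (- s^-1).
    by move=> s0; rewrite /flat s0.
  have tn0 : t != 0 by rewrite gt_eqF.
  have dV : is_derive t 1 (fun s : R => s^-1) (- t^-1 ^+ 2).
    have := @is_deriveV _ id t 1 1 tn0 (is_derive_id _ _).
    by rewrite /GRing.scale/= mulr1 exprVn.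
  apply: (@near_eq_is_derive _ _ _ ((fun s => s^-1) ^+ k * (expR \o (fun s => - s^-1)))).
    near=> s; rewrite flatP//; first by rewrite !fctE.
    by near: s; exact: lt_nbhsr.
  have dN : is_derive t 1 (fun s : R => - s^-1) (t^-1 ^+ 2).
    by rewrite -[X in is_derive _ _ _ X]opprK; exact: is_deriveN.
  have dE : is_derive t 1 (expR \o (fun s : R => - s^-1)) (expR (- t^-1) * t^-1 ^+ 2).
    exact: is_derive1_comp.
  apply: is_derive_eq; rewrite !flatP// /GRing.scale/= !fctE.
  case: k => [|k]; rewrite /= ?exprS; ring.
- rewrite !/(flat _ 0) !ltxx mulr0 addr0.
  suff q0 : h^-1 *: ((flat k \o shift 0) (h *: 1) - flat k 0) @[h --> 0^'] --> (0 : R).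
    by apply: DeriveDef; [apply/cvg_ex; exists 0|exact/cvg_lim].
  (* By [flat_le_sqr] the difference quotient at 0 is at most (k+2)! |h| in absolute value. *)
  apply: (@cvg_to_0_linear _ _ k.+2`!%:R 1) => // h.
  rewrite normr_gt0 => /andP[h0 _].
  rewrite /= addr0 /flat ltxx subr0 -/(flat k _) /GRing.scale/= mulr1.
  rewrite normrM normfV ler_pdivrMl ?normr_gt0// (ger0_norm (flat_ge0 _ _)).
  by rewrite mulrCA -expr2 real_normK ?num_real// flat_le_sqr.
Unshelve. all: end_near. Qed.

Lemma continuous_flat k : continuous (flat k).
Proof.
move=> t; apply: differentiable_continuous; apply/derivable1_diffP.
by have [] := is_derive_flat k t.
Qed.

Lemma cvg_flat0 t : 0 < t -> flat 0 (n%:R * t) @[n --> \oo] --> (1 : R).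
Proof.
(* The shift discards n = 0, where the value is 0; for the other indices the exponent is -1/(n t),
   which tends to 0. *)
move=> t0; rewrite -(cvg_shiftS (fun n => flat 0 (n%:R * t))).
suff : expR (- (t^-1 * n.+1%:R^-1)) @[n --> \oo] --> expR (- (t^-1 * 0)).
  rewrite mulr0 oppr0 expR0; apply: cvg_trans; apply: near_eq_cvg.
  near=> n; rewrite /= /flat mulr_gt0// expr0 mul1r invfM.
  by rewrite mulrC.
apply: (@continuous_cvg _ _ _ _ _ (fun n => - (t^-1 * n.+1%:R^-1)) expR).
  exact: continuous_expR.
by apply: cvgN; apply: cvgM; [exact: cvg_cst|exact: cvg_harmonic].
Unshelve. all: end_near. Qed.

End flat.

(** * An algebra of smooth functions on R^d, and its compactly supported members *)

Section flat_alg.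
Context {R : realType} {d : nat}.
Implicit Type f g : 'rV[R]_d -> R.

(** Closed under partial derivatives, so that membership of the iterated
    derivatives, hence smoothness, follows by induction. *)
Inductive flat_alg : ('rV[R]_d -> R) -> Prop :=
| flat_alg_cst c : flat_alg (cst c)
| flat_alg_flat k a b i : flat_alg (fun x => flat k (a * x 0 i + b))
| flat_algD f g : flat_alg f -> flat_alg g -> flat_alg (f + g)
| flat_algM f g : flat_alg f -> flat_alg g -> flat_alg (f * g).

Lemma flat_alg_continuous f : flat_alg f -> continuous f.
Proof.
elim=> [c|k a b i|{}f g _ cf _ cg|{}f g _ cf _ cg] x.
- exact: cst_continuous.
- apply: (@continuous_comp _ _ _ (fun x : 'rV[R]_d => a * x 0 i + b) (flat k)).
    apply: (@continuousD _ R^o _ (fun y : 'rV[R]_d => a * y 0 i) (cst b)).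
      apply: (@continuousM _ _ (cst a) (fun y : 'rV[R]_d => y 0 i)).
        exact: cst_continuous.
      exact: coord_continuous.
    exact: cst_continuous.
  exact: continuous_flat.
- by apply: continuousD; [exact: cf|exact: cg].
- by apply: (@continuousM _ _ f g); [exact: cf|exact: cg].
Qed.

(** Moving along [delta_mx 0 j] changes coordinate j only, so the difference quotient is that of [u]
    if i = j and is identically 0 otherwise. *)
Lemma is_derive_coord (u : R -> R) (i j : 'I_d) (x : 'rV[R]_d) (l : R) :
  is_derive (x 0 i) 1 u l ->
  is_derive x (delta_mx 0 j) (fun y => u (y 0 i)) ((i == j)%:R * l).
Proof.
move=> [du <-].
pose q h := h^-1 *: (((fun y => u (y 0 i)) \o shift x) (h *: delta_mx 0 j) - u (x 0 i)).
have [ij|ij] := eqVneq i j.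
  have E : q = fun h => h^-1 *: ((u \o shift (x 0 i)) (h *: 1) - u (x 0 i)).
    by apply/funext => h; rewrite /q /= !mxE ij !eqxx.
  rewrite mul1r; apply: DeriveDef; rewrite ?/(derivable _ _ _) ?/(derive _ _ _) -/q E//.
have E : q = cst 0.
  apply/funext => h; rewrite /q /= !mxE (negbTE ij) andbF.
  by rewrite mulr0 add0r subrr scaler0.
have q0 : q h @[h --> 0^'] --> (0 : R) by rewrite E; exact: cvg_cst.
rewrite mul0r; apply: DeriveDef; first by apply/cvg_ex; exists 0.
exact/cvg_lim.
Qed.

Lemma flat_alg_is_derive f (j : 'I_d) : flat_alg f ->
  exists2 g, flat_alg g & forall x, is_derive x (delta_mx 0 j) f (g x).
Proof.
elim=> [c|k a b i|{}f g Af [f' Af' df] Ag [g' Ag' dg]|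
  {}f g Af [f' Af' df] Ag [g' Ag' dg]].
- by exists (cst 0); [exact: flat_alg_cst|move=> x; exact: is_derive_cst].
- pose h l := (fun x : 'rV[R]_d => flat l (a * x 0 i + b)).
  (* Chain rule: [(i == j)%:R] comes from the coordinate map, [a] from the affine map, and the last
     factor from [is_derive_flat]. *)
  exists (cst ((i == j)%:R * a) * (cst (- k%:R) * h k.+1 + h k.+2)).
    apply: flat_algM; first exact: flat_alg_cst.
    apply: flat_algD; last exact: flat_alg_flat.
    by apply: flat_algM; [exact: flat_alg_cst|exact: flat_alg_flat].
  move=> x; rewrite [X in is_derive _ _ _ X]/GRing.mul/= -mulrA.
  apply: (@is_derive_coord (fun s => flat k (a * s + b))).
  rewrite mulrC.
  apply: (@is_derive1_comp _ (flat k) (fun s => a * s + b)).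
    exact: is_derive_flat.
  apply: is_derive_eq.
  by rewrite /GRing.scale/= mulr1 addr0.
- exists (f' + g'); first exact: flat_algD.
  by move=> x; exact: is_deriveD.
- exists (f * g' + g * f'); first by apply: flat_algD; exact: flat_algM.
  by move=> x; exact: is_deriveM.
Qed.

Lemma flat_alg_smooth f : flat_alg f -> smooth f.
Proof.
move=> Af s.
have {Af} Ps : flat_alg (partials s f).
  elim: s => //= i s IH.
  have [g Ag dg] := flat_alg_is_derive _ i IH.
  by rewrite (_ : 'D_ _ _ = g)//; apply/funext => x; have [] := dg x.
split; first exact: flat_alg_continuous.
by move=> i x; have [g Ag /(_ x)[]] := flat_alg_is_derive _ i Ps.
Qed.

Lemma flat_alg_prod (I : Type) (r : seq I) (F : I -> 'rV[R]_d -> R) :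
  (forall i, flat_alg (F i)) -> flat_alg (fun x => \prod_(i <- r) F i x).
Proof.
move=> AF; elim: r => [|i r IH].
  by under eq_fun do rewrite big_nil; exact: flat_alg_cst.
by under eq_fun do rewrite big_cons; exact: flat_algM.
Qed.

Definition flat_bump f :=
  flat_alg f /\ exists k, forall x, f x != 0 -> forall i, `|x 0 i| <= k.

Lemma flat_bump_Cc_infty f : flat_bump f -> Cc_infty f.
Proof.
move=> [Af [k fk]]; split; first exact: flat_alg_smooth.
(* The bound k can be negative, for instance when f vanishes identically, hence the radius |k|. A
   closed ball containing the nonzero set contains its closure, and closed bounded sets are
   compact. *)
have cl : closure [set x | f x != 0] `<=` closed_ball_ Num.norm 0 `|k|.
  rewrite closureE; apply: smallest_sub; first exact: closed_closed_ball_.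
  move=> x /= /fk xk; rewrite /closed_ball_ /= sub0r normrN.
  rewrite [leLHS]/Num.norm/= mx_normrE; apply/bigmax_leP; split => // -[i j] _ /=.
  by rewrite ord1 (le_trans (xk j))// ler_norm.
apply: bounded_closed_compact; last exact: closed_closure.
exists `|k|; split; first exact: num_real.
move=> M kM x /cl /=; rewrite /closed_ball_ /= sub0r normrN => /le_trans; apply.
exact: ltW.
Qed.

Lemma flat_bumpD f g : flat_bump f -> flat_bump g -> flat_bump (f \+ g).
Proof.
move=> [Af [k fk]] [Ag [l gl]]; split; first exact: flat_algD.
exists (Num.max k l) => x /=.
have [f0|f0 _] := eqVneq (f x) 0.
  by rewrite f0 add0r => /gl gx i; rewrite (le_trans (gx i))// le_max lexx orbT.
by move=> i; rewrite (le_trans (fk _ f0 i))// le_max lexx.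
Qed.

Lemma flat_bumpZ c f : flat_bump f -> flat_bump (fun x => c * f x).
Proof.
move=> [Af [k fk]]; split.
  by apply: (flat_algM (cst c)) => //; exact: flat_alg_cst.
by exists k => x; rewrite mulf_eq0 negb_or => /andP[_ /fk].
Qed.

Lemma flat_bump_measurable f : flat_bump f -> measurable_fun setT f.
Proof.
move=> [Af _]; apply: continuous_measurable_fun_rV; exact: flat_alg_continuous.
Qed.

End flat_alg.

(** * The truncated power min(|x|, 1)^p *)

Section tpow.
Context {R : realType}.
Implicit Types p x y c : R.

(** The integrand of the p-th power of [alpha_norm]; working with it postpones the p-th root to the
    very end. *)
Definition tpow p x := Num.min `|x| 1 `^ p.

Lemma tpow_ge0 p x : 0 <= tpow p x.
Proof. exact: powR_ge0. Qed.

Let min_ge0 x : 0 <= Num.min `|x| 1.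
Proof. by rewrite le_min normr_ge0 ler01. Qed.

Lemma tpow_le1 p x : 0 <= p -> tpow p x <= 1.
Proof.
move=> p0; rewrite [leRHS](_ : _ = 1 `^ p); last by rewrite powR1.
by apply: ge0_ler_powR; rewrite ?nnegrE// ge_min lexx orbT.
Qed.

Lemma tpow0 p : 0 < p -> tpow p 0 = 0.
Proof. by move=> p0; rewrite /tpow normr0 min_l// powR0// gt_eqF. Qed.

(** A number in [0, 1] does not increase when raised to a power p >= 1. This turns pointwise
    convergence into convergence of the truncated powers. *)
Lemma tpow_le_norm p x : 1 <= p -> tpow p x <= `|x|.
Proof.
move=> p1; have [->|x0] := eqVneq x 0.
  by rewrite tpow0 ?normr0// (lt_le_trans ltr01).
rewrite (@le_trans _ _ (Num.min `|x| 1))//; last by rewrite ge_min lexx.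
by rewrite /tpow ge1r_powR// lt_min normr_gt0 x0 ltr01/= ge_min lexx orbT.
Qed.

Lemma tpow_le_powR p x : 0 <= p -> tpow p x <= `|x| `^ p.
Proof.
by move=> p0; apply: ge0_ler_powR; rewrite ?nnegrE// ge_min lexx.
Qed.

(** The truncation of x + y is at most twice the larger of the two truncations, and the p-th power
    of a maximum is at most the sum of the p-th powers. *)
Lemma tpowD p x y : 0 <= p -> tpow p (x + y) <= 2 `^ p * (tpow p x + tpow p y).
Proof.
move=> p0; set m := Num.max (Num.min `|x| 1) (Num.min `|y| 1).
have m0 : 0 <= m by rewrite le_max min_ge0.
apply: (@le_trans _ _ ((2 * m) `^ p)).
  apply: ge0_ler_powR; rewrite ?nnegrE// ?mulr_ge0//.
  have xy := ler_normD x y.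
  rewrite /m maxEle; case: ifPn; rewrite ?minEle; do ?case: ifPn; lra.
rewrite powRM// ler_wpM2l ?powR_ge0// /m maxEle; case: ifPn => _.
  by rewrite lerDr tpow_ge0.
by rewrite lerDl tpow_ge0.
Qed.

(** If |x| <= 1, use |c x| <= max(|c|, 1) |x|; if |x| > 1, the left side is at most 1. The maximum
    is there because for |c| < 1 and large x the truncation does not scale by |c|. *)
Lemma tpowM p c x : 0 <= p -> tpow p (c * x) <= Num.max `|c| 1 `^ p * tpow p x.
Proof.
move=> p0; have M0 : 0 <= Num.max `|c| 1 by rewrite le_max normr_ge0.
rewrite -powRM//; apply: ge0_ler_powR; rewrite ?nnegrE ?mulr_ge0//.
rewrite normrM.
have [x1|x1] := leP `|x| 1.
  by rewrite ge_min; apply/orP; left; apply: ler_wpM2r => //; rewrite le_max lexx.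
by rewrite mulr1 ge_min; apply/orP; right; rewrite le_max lexx orbT.
Qed.

Lemma measurable_tpow p : measurable_fun setT (tpow p).
Proof.
apply: (measurableT_comp (measurable_powR _)).
apply: measurable_minr => //; exact: measurable_normr.
Qed.

Lemma cvg_tpow p (u : nat -> R) l : 1 <= p -> u @ \oo --> l ->
  tpow p (l - u n) @[n --> \oo] --> (0 : R).
Proof.
move=> p1 ul; have ul0 : `|l - u n| @[n --> \oo] --> (0 : R).
  rewrite -(normr0 R) -(subrr l); apply: cvg_norm; apply: cvgB => //.
  exact: cvg_cst.
apply: (@squeeze_cvgr _ _ _ _ (cst 0) (fun n => `|l - u n|)) => //; last exact: cvg_cst.
by near=> n; rewrite tpow_ge0 tpow_le_norm.
Unshelve. all: end_near. Qed.

End tpow.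

(** * Limits of bumps for the truncated integral, and their closure properties *)

Section approximable.
Context {R : realType} {d : nat}.
Variables (p : R) (p1 : 1 <= p).
Local Notation mu := (lebesgue_rV d).
Local Notation T := 'rV[R]_d.
Implicit Types f g : T -> R.

Let p0 : 0 <= p. Proof. exact: le_trans p1. Qed.
Let p_gt0 : 0 < p. Proof. exact: lt_le_trans p1. Qed.

Definition tint f : \bar R := (\int[mu]_x (tpow p (f x))%:E)%E.

Let measurable_tpow_comp f : measurable_fun setT f ->
  measurable_fun setT (fun x => (tpow p (f x))%:E).
Proof.
move=> mf; apply/measurable_EFinP.
exact: measurableT_comp (measurable_tpow p) mf.
Qed.

Lemma tintD f g : measurable_fun setT f -> measurable_fun setT g ->
  (tint (f \+ g)%R <= (2 `^ p)%:E * (tint f + tint g))%E.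
Proof.
move=> mf mg; rewrite /tint -ge0_integralD//=;
  [|by move=> x _; rewrite lee_fin tpow_ge0|exact: measurable_tpow_comp
   |by move=> x _; rewrite lee_fin tpow_ge0|exact: measurable_tpow_comp].
rewrite -ge0_integralZl//=;
  [|by apply: emeasurable_funD; exact: measurable_tpow_comp
   |by move=> x _; rewrite adde_ge0// lee_fin tpow_ge0].
apply: ge0_le_integral => //=.
- by move=> x _; rewrite lee_fin tpow_ge0.
- by apply: measurable_tpow_comp; exact: measurable_funD.
- apply: measurable_funeM; apply: emeasurable_funD; exact: measurable_tpow_comp.
- by move=> x _; rewrite -EFinD -EFinM lee_fin tpowD.
Qed.

Lemma tintZ c f : measurable_fun setT f ->
  (tint (fun x => c * f x)%R <= (Num.max `|c| 1 `^ p)%:E * tint f)%E.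
Proof.
move=> mf; rewrite /tint -ge0_integralZl//=;
  [|exact: measurable_tpow_comp|by move=> x _; rewrite lee_fin tpow_ge0].
apply: ge0_le_integral => //=.
- by move=> x _; rewrite lee_fin tpow_ge0.
- by apply: measurable_tpow_comp; exact: measurable_funM.
- by apply: measurable_funeM; exact: measurable_tpow_comp.
- by move=> x _; rewrite -EFinM lee_fin tpowM.
Qed.

Lemma tint_cvg0 f (g : nat -> T -> R) (G : T -> R) :
  measurable_fun setT f -> (forall n, measurable_fun setT (g n)) ->
  (forall x, g n x @[n --> \oo] --> f x) ->
  mu.-integrable setT (EFin \o G) ->
  (forall n x, tpow p (f x - g n x) <= G x) ->
  tint (f \- g n) @[n --> \oo] --> 0%E.
Proof.
move=> mf mg gf iG fgG.
rewrite -(integral0 mu setT).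
apply: (@dominated_cvg _ _ _ mu setT measurableT
  (fun n x => (tpow p (f x - g n x))%:E) (cst 0) (EFin \o G)) => //.
- by move=> n; apply: measurable_tpow_comp; exact: measurable_funB.
- by move=> x _; apply: cvg_EFin; [exact: nearW|exact: cvg_tpow].
- by move=> n x _; rewrite gee0_abs ?lee_fin// tpow_ge0.
Qed.

Definition approximable f := measurable_fun setT f /\
  forall e : R, 0 < e -> exists2 phi, flat_bump phi & (tint (f \- phi)%R < e%:E)%E.

Lemma approximable_near f : measurable_fun setT f ->
  (forall e : R, 0 < e -> exists2 g, approximable g & (tint (f \- g)%R < e%:E)%E) ->
  approximable f.
Proof.
move=> mf fg; split=> // e e0.
have P0 : 0 < 2 `^ p :> R by rewrite powR_gt0.
(* Each of the two errors gets half of e, divided by the constant 2^p of [tintD]. *)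
have e20 : 0 < e / 2 / 2 `^ p by rewrite !divr_gt0.
have [g [mg /(_ _ e20)[phi bphi gphi]] /= fge] := fg _ e20.
exists phi => //.
have mphi := flat_bump_measurable _ bphi.
have -> : f \- phi = (f \- g) \+ (g \- phi) by apply/funext => x /=; ring.
apply: (le_lt_trans (tintD _ _ _ _)); [exact: measurable_funB..|].
rewrite muleC -lte_pdivlMr//.
have -> : (e%:E * (2 `^ p)^-1%:E = (e / 2 / 2 `^ p)%:E + (e / 2 / 2 `^ p)%:E)%E.
  by rewrite -EFinD -EFinM -mulrDl -splitr.
exact: lteD.
Qed.

Lemma flat_bump_approximable f : flat_bump f -> approximable f.
Proof.
move=> bf; split; first exact: flat_bump_measurable.
move=> e e0; exists f => //; rewrite /tint.
under eq_integral do rewrite /= subrr tpow0//.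
by rewrite integral0 lte_fin.
Qed.

Lemma approximableD f g : approximable f -> approximable g -> approximable (f \+ g).
Proof.
move=> [mf Af] [mg Ag]; split; first exact: measurable_funD.
move=> e e0; have P0 : 0 < 2 `^ p :> R by rewrite powR_gt0.
have e20 : 0 < e / 2 / 2 `^ p by rewrite !divr_gt0.
have [phi bphi fphi] := Af _ e20; have [psi bpsi gpsi] := Ag _ e20.
exists (phi \+ psi); first exact: flat_bumpD.
have mphi := flat_bump_measurable _ bphi.
have mpsi := flat_bump_measurable _ bpsi.
have -> : (f \+ g) \- (phi \+ psi) = (f \- phi) \+ (g \- psi).
  by apply/funext => x /=; ring.
apply: (le_lt_trans (tintD _ _ _ _)); [exact: measurable_funB..|].
rewrite muleC -lte_pdivlMr//.
have -> : (e%:E * (2 `^ p)^-1%:E = (e / 2 / 2 `^ p)%:E + (e / 2 / 2 `^ p)%:E)%E.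
  by rewrite -EFinD -EFinM -mulrDl -splitr.
exact: lteD.
Qed.

Lemma approximableZ c f : approximable f -> approximable (fun x => c * f x).
Proof.
move=> [mf Af]; split; first exact: measurable_funM.
have C0 : 0 < Num.max `|c| 1 `^ p by rewrite powR_gt0// lt_max ltr01 orbT.
move=> e e0; have [phi bphi fphi] := Af _ (divr_gt0 e0 C0).
exists (fun x => c * phi x); first exact: flat_bumpZ.
have mphi := flat_bump_measurable _ bphi.
rewrite (_ : _ \- _ = fun x => c * (f \- phi) x); last first.
  by apply/funext => x /=; ring.
apply: (le_lt_trans (tintZ _ _ _)); first exact: measurable_funB.
by rewrite muleC -lte_pdivlMr.
Qed.

Lemma approximable_cvg f (g : nat -> T -> R) (G : T -> R) :
  measurable_fun setT f -> (forall n, approximable (g n)) ->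
  (forall x, g n x @[n --> \oo] --> f x) ->
  mu.-integrable setT (EFin \o G) ->
  (forall n x, tpow p (f x - g n x) <= G x) ->
  approximable f.
Proof.
move=> mf Ag gf iG fgG; apply: approximable_near => // e e0.
have := tint_cvg0 _ _ _ mf (fun n => (Ag n).1) gf iG fgG.
move=> /(_ [set y | (y < e%:E)%E])[|N _ /(_ N)].
  apply: open_nbhs_nbhs; split; first exact: open_ereal_lt_ereal.
  by rewrite /= lte_fin.
by move=> /= h; exists (g N) => //; exact: h.
Qed.

(** The truncated power never exceeds 1 and the differences vanish off A, so [\1_A] dominates
    whatever the size of f and of the [g n]. *)
Lemma approximable_cvg_supp (A : set T) f (g : nat -> T -> R) :
  measurable A -> (mu A < +oo)%E ->
  measurable_fun setT f -> (forall n, approximable (g n)) ->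
  (forall x, g n x @[n --> \oo] --> f x) ->
  (forall x, ~ A x -> f x = 0) -> (forall n x, ~ A x -> g n x = 0) ->
  approximable f.
Proof.
move=> mA Aoo mf Ag gf f0 g0; apply: (approximable_cvg _ g \1_A) => //.
  apply/integrableP; split; first exact/measurable_EFinP/measurable_indic.
  rewrite (eq_integral (fun x => (\1_A x)%:E)).
    by rewrite integral_indic// setIT.
  by move=> x _; rewrite gee0_abs// lee_fin.
move=> n x; rewrite indicE; case: (boolP (x \in A)) => [_|]; first exact: tpow_le1.
rewrite notin_setE => Ax; by rewrite f0// g0// subrr tpow0.
Qed.

End approximable.

(** * Open boxes: a generating pi-system, and bumps converging to their indicators *)

Section open_boxes.
Context {R : realType} {d : nat}.
Local Notation T := 'rV[R]_d.
Implicit Types a b x : T.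

Definition obox a b : set T := [set x | forall i, x 0 i \in `]a 0 i, b 0 i[].

Lemma measurable_obox a b : measurable (obox a b).
Proof.
rewrite (_ : obox a b = \bigcap_(i : 'I_d) ((fun x : T => x 0 i) @^-1` `]a 0 i, b 0 i[)).
  apply: fin_bigcap_measurable => // i _.
  by rewrite -[X in measurable X]setTI; exact: measurable_coord.
by apply/seteqP; split=> x /= ab i; [move=> _|]; exact: ab.
Qed.

Lemma obox_lty a b : (lebesgue_rV d (obox a b) < +oo)%E.
Proof.
rewrite /obox (lebesgue_rV_box (A := fun i => `]a 0 i, b 0 i[%classic))//.
rewrite ltey_eq prode_fin_num// => i _.
by rewrite lebesgue_measure_itv/=; case: ifPn.
Qed.

(** Stability under intersection is the pi-system hypothesis of Dynkin's theorem. *)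
Lemma oboxI a b a' b' : obox a b `&` obox a' b' =
  obox (\row_i Num.max (a 0 i) (a' 0 i)) (\row_i Num.min (b 0 i) (b' 0 i)).
Proof.
apply/seteqP; split => x /=.
  move=> [xab xab'] i; have := xab i; have := xab' i.
  rewrite !in_itv/= !mxE gt_max lt_min.
  by move=> /andP[-> ->] /andP[-> ->].
move=> xab; split=> i; have := xab i; rewrite !in_itv/= !mxE gt_max lt_min.
  by move=> /andP[/andP[-> _] /andP[-> _]].
by move=> /andP[/andP[_ ->] /andP[_ ->]].
Qed.

Lemma ball_obox x (e : R) : 0 < e ->
  ball x e = obox (\row_i (x 0 i - e)) (\row_i (x 0 i + e)).
Proof.
move=> e0; apply/seteqP; split => y /=.
  move=> [_ xy] i; rewrite in_itv/= !mxE -ltr_distl distrC.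
  by have := xy 0 i.
move=> xy; split=> // i j; rewrite ord1.
have := xy j; rewrite in_itv/= !mxE -ltr_distl distrC.
by [].
Qed.

(** An open set is a countable union of balls with rational centres and radii 1/(k+1), and balls of
    the sup norm are open boxes. *)
Lemma measurable_boxes (A : set T) : measurable A ->
  <<s [set obox a b | a in setT & b in setT] >> A.
Proof.
apply: smallest_sub; first exact: smallest_sigma_algebra.
move=> U oU.
rewrite (open_bigcup_ratball oU) bigcup_mkcond.
apply: (@countable_bigcupT_measurable _
  (g_sigma_algebraType [set obox a b | a in setT & b in setT])).
  exact: countableP.
move=> [q k]; case: ifPn => _; last exact: measurable0.
apply: sub_sigma_algebra; rewrite ball_obox ?invr_gt0//.
by eexists => //; eexists.
Qed.

Lemma coord_le_norm x i : `|x 0 i| <= `|x|.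
Proof.
rewrite [leRHS]/Num.norm/= mx_normrE.
exact: (le_bigmax _ (fun ij : 'I_1 * 'I_d => `|x ij.1 ij.2|) (0, i)).
Qed.

(** The arguments n (x_i - a_i) and n (b_i - x_i) are expanded into the affine form required by
    [flat_alg_flat]. *)
Definition box_bump (n : nat) a b x := \prod_(i < d)
  (flat 0 (n%:R * x 0 i + - (n%:R * a 0 i)) *
   flat 0 (- n%:R * x 0 i + n%:R * b 0 i)).

Lemma box_bump_supp n a b x : box_bump n a b x != 0 -> obox a b x.
Proof.
move=> /prodf_neq0 x0 i; have /(_ isT) := x0 i.
rewrite mulf_eq0 negb_or in_itv/= => /andP[/flat_neq0_gt0 + /flat_neq0_gt0].
(* Arguing by contraposition avoids dividing by n, which may be 0. *)
have key (u v : R) : 0 < n%:R * u - n%:R * v -> v < u.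
  by rewrite subr_gt0 !ltNge; apply: contra; exact: ler_wpM2l.
by move=> /key ->; rewrite mulNr addrC => /key ->.
Qed.

Lemma flat_bump_box n a b : flat_bump (box_bump n a b).
Proof.
split.
  apply: flat_alg_prod => i.
  by apply: (flat_algM (fun x => flat 0 _) (fun x => flat 0 _));
    exact: flat_alg_flat.
(* In the box each x_i lies between -|a| and |b|. *)
exists (`|a| + `|b|) => x /box_bump_supp xab i.
have := xab i; rewrite in_itv/= => /andP[ax xb].
have := coord_le_norm a i; have := coord_le_norm b i.
rewrite !ler_norml => /andP[_ bi] /andP[ai _].
by have := normr_ge0 a; have := normr_ge0 b; lra.
Qed.

(** Outside the open box, its boundary included, every bump vanishes; inside, each of the finitely
    many factors tends to 1 by [cvg_flat0]. *)
Lemma cvg_box_bump a b x : box_bump n a b x @[n --> \oo] --> (\1_(obox a b) x : R).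
Proof.
rewrite indicE; case: (boolP (x \in _)) => [|xab]; last first.
  apply: cvg_near_cst; apply: nearW => n; apply/eqP.
  by apply: contraNT xab => /box_bump_supp; rewrite inE.
rewrite inE /box_bump => xab.
rewrite (_ : true%:R = \prod_(i < d) (1 : R)); last by rewrite big1.
elim: (index_enum _) => [|i r IH].
  under eq_fun do rewrite big_nil; rewrite big_nil; exact: cvg_cst.
under eq_fun do rewrite big_cons; rewrite big_cons; apply: cvgM => //.
have /andP[ax xb] := xab i.
rewrite -[X in _ --> X]mulr1; apply: cvgM.
  under eq_fun do rewrite -mulrBr; apply: cvg_flat0.
  by rewrite subr_gt0.
under eq_fun do rewrite mulNr addrC -mulrBr; apply: cvg_flat0.
by rewrite subr_gt0.
Qed.

End open_boxes.

(** * From boxes to Borel sets, measurable functions and Lambda_p *)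

Section density.
Import HBSimple.
Context {R : realType} {d : nat}.
Variables (p : R) (p1 : 1 <= p).
Local Notation mu := (lebesgue_rV d).
Local Notation T := 'rV[R]_d.
Implicit Types f g : T -> R.

Lemma approximable_obox (a b : T) : approximable p (\1_(obox a b) : T -> R).
Proof.
apply: (approximable_cvg_supp p p1 (obox a b) _ (fun n => box_bump n a b)).
- exact: measurable_obox.
- exact: obox_lty.
- by apply: measurable_indic; exact: measurable_obox.
- by move=> n; apply: (flat_bump_approximable p p1); exact: flat_bump_box.
- exact: cvg_box_bump.
- by move=> x xab; rewrite indicE memNset.
- by move=> n x xab; apply/eqP; apply: contra_notT xab => /box_bump_supp.
Qed.

(** The sets A with this property form a lambda-system containing the boxes. Intersecting with a
    fixed box keeps all supports in one set of finite measure, as [approximable_cvg_supp]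
    requires. *)
Lemma approximable_indic (A : set T) (a b : T) : measurable A ->
  approximable p (\1_(A `&` obox a b) : T -> R).
Proof.
pose H := [set A : set T | measurable A /\ approximable p (\1_(A `&` obox a b) : T -> R)].
move=> /measurable_boxes mA; suff : H A by case.
apply: lambda_system_subset mA => //.
- move=> _ _ [a1 _ [b1 _ <-]] [a2 _ [b2 _ <-]]; rewrite oboxI.
  by eexists => //; eexists.
- split; first by move=> ? ?; exact: subsetT.
  + by split; [exact: measurableT|rewrite setTI; exact: approximable_obox].
  + move=> A1 A2 A21 [mA1 HA1] [mA2 HA2]; split; first exact: measurableD.
    (* Since A2 is contained in A1, the indicator of the proper difference is the difference of the
       indicators. *)
    have -> : \1_((A1 `\` A2) `&` obox a b) = (\1_(A1 `&` obox a b) : T -> R) \+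
        (fun x => -1 * (\1_(A2 `&` obox a b) x : R)).
      apply/funext => x; rewrite /= !indicE (in_setI _ (A1 `\` A2)) in_setD !in_setI.
      have A21x : x \in A2 -> x \in A1 by rewrite !inE => /A21.
      case: (x \in A2) A21x => [->//|_]; case: (x \in A1); case: (x \in obox a b);
        rewrite /=; ring.
    apply: (approximableD p p1); first exact: HA1.
    by apply: (approximableZ p p1); exact: HA2.
  + move=> F ndF HF.
    have mF : measurable (\bigcup_n F n).
      by apply: bigcup_measurable => n _; exact: (HF n).1.
    split; first exact: mF.
    apply: (approximable_cvg_supp p p1 (obox a b) _ (fun n => \1_(F n `&` obox a b))).
    * exact: measurable_obox.
    * exact: obox_lty.
    * by apply: measurable_indic; apply: measurableI => //; exact: measurable_obox.
    * by move=> n; exact: (HF n).2.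
    (* The union is increasing, so at each point the sequence of indicators is eventually
       constant. *)
    * move=> x; have [[n _ Fnx]|nF] := pselect ((\bigcup_n F n) x).
        apply: cvg_near_cst; near=> m.
        have Fmx : F m x.
          by move: Fnx; apply/subsetPset/ndF; near: m; exact: nbhs_infty_ge.
        have Fx : (\bigcup_n F n) x by exists n.
        by rewrite !indicE !in_setI (mem_set Fmx) (mem_set Fx).
      apply: cvg_near_cst; near=> m.
      have nFm : ~ F m x by move=> Fm; apply: nF; exists m.
      by rewrite !indicE !in_setI (memNset nF) (memNset nFm).
    * by move=> x xab; rewrite indicE memNset// => -[].
    * by move=> n x xab; rewrite indicE memNset// => -[].
- move=> _ [a1 _ [b1 _ <-]]; split; first exact: measurable_obox.
  by rewrite oboxI; exact: approximable_obox.
Unshelve. all: end_near. Qed.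

Lemma approximable_sum (I : Type) (r : seq I) (F : I -> T -> R) :
  (forall i, approximable p (F i)) -> approximable p (fun x => \sum_(i <- r) F i x).
Proof.
move=> AF; elim: r => [|i r IH].
  under eq_fun do rewrite big_nil.
  apply: (flat_bump_approximable p p1); split; first exact: flat_alg_cst.
  by exists 0 => x; rewrite eqxx.
by under eq_fun do rewrite big_cons; exact: (approximableD p p1 (F i) _ (AF i) IH).
Qed.

(** Simple functions converge to f pointwise; truncation and the finite measure of the box supply
    the domination even when f is unbounded. *)
Lemma approximable_obox_fun f (a b : T) : measurable_fun setT f ->
  approximable p (f \* \1_(obox a b)).
Proof.
move=> mf.
have mfE : measurable_fun setT (EFin \o f) by exact/measurable_EFinP.
have [g gf] := approximation_sfun measurableT mfE.
have mb := measurable_obox a b.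
apply: (approximable_cvg_supp p p1 (obox a b) _ (fun n => g n \* \1_(obox a b))).
- exact: mb.

- exact: obox_lty.
- by apply: measurable_funM => //; exact: measurable_indic.
- move=> n.
  (* A simple function is the finite sum, over its values y, of y times the indicator of its level
     set. *)
  rewrite (_ : _ \* _ = fun x => \sum_(y <- finmap.enum_fset (fset_set (range (g n))))
      y * (\1_((g n @^-1` [set y]) `&` obox a b) x : R)).
    apply: approximable_sum => y; apply: (approximableZ p p1).
    apply: approximable_indic; exact: measurable_funPTI.
  apply/funext => x /=; rewrite {1}fimfunE fsbig_finite//= mulr_suml.
  by apply: eq_bigr => y _; rewrite -mulrA indicI.
- move=> x; apply: cvgM; last exact: cvg_cst.
  have := gf x I; move/fine_cvg => /=; apply.
- by move=> x xab; rewrite /= indicE memNset// mulr0.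
- by move=> n x xab; rewrite /= indicE memNset// mulr0.
Qed.

(** Take delta = 1: on the exceptional set E the integrand is at most 1 and E has measure below 1;
    off E it is at most |f|^p, which is integrable there. *)
Lemma Lambda_tint_lty f : Lambda p f -> (tint p f < +oo)%E.
Proof.
move=> [mf /(_ 1 ltr01)[E [mE E1]]]; rewrite inE => /andP[].
rewrite !inE => mg goo; set g := f \* _ in mg goo.
have pn0 : p != 0 by rewrite gt_eqF// (lt_le_trans ltr01).
have mgp : measurable_fun setT (fun x => (`|g x| `^ p)%:E).
  apply/measurable_EFinP; apply: (measurableT_comp (measurable_powR _)).
  exact: measurableT_comp.
have mE1 : measurable_fun setT (fun x => (\1_E x)%:E : \bar R).
  exact/measurable_EFinP/measurable_indic.
apply: (@le_lt_trans _ _ (\int[mu]_x ((\1_E x)%:E + (`|g x| `^ p)%:E))%E).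
  apply: ge0_le_integral => //.
  - by move=> x _; rewrite lee_fin tpow_ge0.
  - by apply/measurable_EFinP; exact: measurableT_comp (measurable_tpow p) mf.
  - exact: emeasurable_funD.
  - move=> x _; rewrite -EFinD lee_fin /g /= indicC !indicE.
    have p0 : 0 <= p by exact: le_trans p1.
    case: (x \in E) => /=; first by rewrite (le_trans (tpow_le1 _ _ p0))// lerDl powR_ge0.
    by rewrite add0r mulr1 tpow_le_powR.
rewrite ge0_integralD// integral_indic// setIT lte_add_pinfty//.
  exact: lt_trans E1 (ltry _).
by have := poweR_lty p goo; rewrite poweR_Lnorm.
Qed.

Lemma Lambda_approximable f : Lambda p f -> approximable p f.
Proof.
move=> Lf; have [mf _] := Lf.
pose B n := obox (const_mx (- n%:R) : T) (const_mx n%:R).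
(* The difference between f and its restriction to [B n] is 0 or f at each point, so [tpow p (f x)]
   dominates. *)
apply: (approximable_cvg p p1 f (fun n => f \* \1_(B n)) (fun x => tpow p (f x))) => //.
- by move=> n; exact: approximable_obox_fun.
(* As soon as n exceeds the sup norm of x, the point lies in [B n] and the sequence is constant. *)
- move=> x; apply: cvg_near_cst; near=> n.
  rewrite /= indicE mem_set ?mulr1// => i.
  rewrite in_itv/= !mxE -ltr_norml (le_lt_trans (coord_le_norm _ _))//.
  near: n; exact: nbhs_infty_gtr.
- apply/integrableP; split.
    apply/measurable_EFinP; exact: measurableT_comp (measurable_tpow p) mf.
  rewrite (eq_integral (fun x => (tpow p (f x))%:E)); first exact: Lambda_tint_lty.
  by move=> x _; rewrite gee0_abs// lee_fin tpow_ge0.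
- move=> n x; rewrite /= indicE; case: (x \in B n).
    by rewrite mulr1 subrr tpow0 ?tpow_ge0// (lt_le_trans ltr01).
  by rewrite mulr0 subr0.
Unshelve. all: end_near. Qed.

Lemma alpha_norm_lt f (e : R) : 0 < e -> (tint p f < (e `^ p)%:E)%E ->
  (alpha_norm p f < e%:E)%E.
Proof.
move=> e0; have p0 : 0 < p by exact: lt_le_trans p1.
have -> : tint p f = (alpha_norm p f `^ p)%E.
  rewrite /alpha_norm (poweR_Lnorm _ _ (lt0r_neq0 p0)).
  apply: eq_integral => x _ /=.
  by rewrite ger0_norm// le_min normr_ge0 ler01.
(* Monotonicity of the p-th power on [0, +oo] is available for <=, so the strict inequality is
   obtained by contraposition. *)
rewrite !ltNge; apply: contra => eN; rewrite -poweR_EFin.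
apply: gt0_ler_poweR => //; first exact: ltW.
- by rewrite in_itv/= lee_fin ltW//= leey.
- by rewrite in_itv/= Lnorm_ge0 leey.
Qed.

End density.

Theorem proposition6p3 (R : realType) (d : nat) (p : R) (hp : 1 <= p)
    (f : 'rV[R]_d -> R) (hf : Lambda p f) (eps : R) (heps : 0 < eps) :
  exists2 phi : 'rV[R]_d -> R,
    Cc_infty phi & (alpha_norm p (f \- phi)%R < eps%:E)%E.
Proof.
have ep0 : 0 < eps `^ p by rewrite powR_gt0.
(* The tolerance is eps^p because the truncated integral is the p-th power of [alpha_norm]. *)
have [_ /(_ _ ep0)[phi bphi fphi]] := Lambda_approximable _ hp _ hf.
by exists phi; [exact: flat_bump_Cc_infty|exact: alpha_norm_lt].
Qed.
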